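(* Let $(X,\Sigma,\mu)$ be a semi-finite measure space and let $A\in\Sigma$ satisfy $\mu(A)\neq0$ and contain no $\mu$-atoms. Then $\tau_O(L^\infty)\neq\tau(L^\infty,L^1)$.
   Context: $L^\infty$, $L^1$ are the real spaces of essentially bounded, resp. integrable, functions; $\tau(L^\infty,L^1)$ is the Mackey topology of the duality $\langle f,g\rangle=\int fg\,d\mu$ (uniform convergence on absolutely convex $\sigma(L^1,L^\infty)$-compact subsets of $L^1$). $\tau_O(L^\infty)$ is the order topology of the Riesz space $L^\infty$ (a.e. pointwise order): its closed sets are the sets $F$ such that no net in $F$ order converges to a point outside $F$, where $(x_\gamma)_{\gamma\in\Gamma}$ order converges to $x$ if there are nets $(y_\gamma)_{\gamma\in\Gamma}$ increasing with supremum $x$ and $(z_\gamma)_{\gamma\in\Gamma}$ decreasing with infimum $x$ with eventually $y_\gamma\le x_\gamma\le z_\gamma$. A $\mu$-atom is a set $E\in\Sigma$ with $\mu(E)>0$ such that every measurable subset $F\subseteq E$ has $\mu(F)=0$ or $\mu(E\setminus F)=0$. *)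

(* Defs.v *)
From HB Require Import structures.
From mathcomp Require Import all_boot all_order all_algebra.
From mathcomp Require Import all_classical all_reals all_analysis.
Set Implicit Arguments. Unset Strict Implicit. Unset Printing Implicit Defensive.
Import Order.TTheory GRing.Theory Num.Theory.
Local Open Scope classical_set_scope.
Local Open Scope ring_scope.

Section Defs.
Context {d : measure_display} {T : measurableType d} {R : realType}.
Variable mu : {measure set T -> \bar R}.

Definition semi_finite : Prop :=
  forall E, measurable E -> mu E = +oo%E ->
    exists F, [/\ measurable F, F `<=` E, (0 < mu F)%E & (mu F < +oo)%E].

Definition mu_atom (E : set T) : Prop :=
  [/\ measurable E, (0 < mu E)%E &
    forall F, measurable F -> F `<=` E -> mu F = 0%E \/ mu (E `\` F) = 0%E].

Definition no_atoms_in (A : set T) : Prop :=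
  ~ exists E, E `<=` A /\ mu_atom E.

(* representatives of elements of L^oo and L^1 *)
Definition Linf (f : T -> R) : Prop :=
  measurable_fun setT f /\ exists M : R, {ae mu, forall x, `|f x| <= M}.

Definition L1 (g : T -> R) : Prop :=
  mu.-integrable setT (EFin \o g).

Definition pairing (f g : T -> R) : R := fine (\int[mu]_x (f x * g x)%:E).

Definition weak_open (W : set (T -> R)) : Prop :=
  W `<=` L1 /\
  forall g, W g -> exists (n : nat) (fs : nat -> T -> R) (e : R),
    [/\ (forall i, (i < n)%N -> Linf (fs i)), 0 < e &
      forall h, L1 h -> (forall i, (i < n)%N -> `|pairing (fs i) (h \- g)| < e) -> W h].

Definition weak_compact (K : set (T -> R)) : Prop :=
  K `<=` L1 /\
  forall C : set (set (T -> R)), (forall W, C W -> weak_open W) ->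
    (forall h, K h -> exists W, C W /\ W h) ->
    exists (n : nat) (Ws : nat -> set (T -> R)),
      (forall i, (i < n)%N -> C (Ws i)) /\
      (forall h, K h -> exists i, (i < n)%N /\ Ws i h).

Definition abs_convex (K : set (T -> R)) : Prop :=
  forall g1 g2 (a b : R), K g1 -> K g2 -> `|a| + `|b| <= 1 ->
    K (fun x => a * g1 x + b * g2 x).

Definition mackey_open (U : set (T -> R)) : Prop :=
  U `<=` Linf /\
  forall f, U f -> exists (n : nat) (Ks : nat -> set (T -> R)) (e : R),
    [/\ (forall i, (i < n)%N -> abs_convex (Ks i) /\ weak_compact (Ks i)), 0 < e &
      forall h, Linf h ->
        (forall i, (i < n)%N -> forall g, Ks i g -> `|pairing (h \- f) g| < e) -> U h].

Definition mackey_closed (F : set (T -> R)) : Prop :=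
  F `<=` Linf /\ mackey_open (Linf `\` F).

Definition ae_le (f g : T -> R) : Prop := {ae mu, forall x, f x <= g x}.

Definition directed (G : Type) (le : G -> G -> Prop) : Prop :=
  [/\ (forall a, le a a), (forall a b c, le a b -> le b c -> le a c),
      inhabited G & (forall a b, exists c, le a c /\ le b c)].

Definition order_conv (G : Type) (le : G -> G -> Prop)
    (xs : G -> T -> R) (x : T -> R) : Prop :=
  exists ys zs : G -> T -> R,
    (forall a, Linf (ys a) /\ Linf (zs a)) /\
    (forall a b, le a b -> ae_le (ys a) (ys b)) /\
    (forall a, ae_le (ys a) x) /\
    (forall u, Linf u -> (forall a, ae_le (ys a) u) -> ae_le x u) /\
    (forall a b, le a b -> ae_le (zs b) (zs a)) /\
    (forall a, ae_le x (zs a)) /\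
    (forall u, Linf u -> (forall a, ae_le u (zs a)) -> ae_le u x) /\
    (exists a0, forall a, le a0 a -> ae_le (ys a) (xs a) /\ ae_le (xs a) (zs a)).

Definition order_closed (F : set (T -> R)) : Prop :=
  F `<=` Linf /\
  forall (G : Type) (le : G -> G -> Prop), directed le ->
    forall (xs : G -> T -> R) (x : T -> R),
      (forall a, F (xs a)) -> Linf x -> order_conv le xs x -> F x.

End Defs.

(* Main.v *)
Require Import Defs.
From mathcomp Require Import all_boot all_order all_algebra.
From mathcomp Require Import all_classical all_reals all_analysis.
From mathcomp Require Import measurable_realfun.
From mathcomp Require Import ring lra.
Import Order.TTheory GRing.Theory Num.Theory.
Import numFieldNormedType.Exports.
Local Open Scope classical_set_scope.
Local Open Scope ring_scope.

(** Inside the atomless part take disjoint sets [E1], [E2] of finite positive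
measure, sets [B p] in [E1] at mutual distance [mu E1 / 2] (Rademacher-like),
nonnull [V p] in [E2] with [mu (V p) -> 0], and a map [nu] taking each natural
number infinitely often.  The set of spikes
  [1 / (nu p + 1) * 1_(B p) + (nu p + 1) * 1_(V p)]
separates the topologies.

It is order closed: an order convergent net is eventually bounded, which bounds
[nu], hence keeps distinct spikes apart on [E1] by a fixed gap on a set of fixed
measure, whereas the gap between the two squeezing nets tends to 0 in measure;
so a net of spikes is eventually constant.

It is not Mackey closed, since it omits 0 but meets each Mackey neighbourhood of
0: a weakly compact absolutely convex [K] in [L^1] is uniformly integrable (a
gliding hump argument), so by atomlessness the integrals over the [B p] are
bounded on [K]; choose first [nu p] large, then [p] large. *)

(** * Subsets of prescribed measure in an atomless set of finite measure *)

Section FiniteAtomless.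
Set Implicit Arguments. Unset Strict Implicit.
Context {d : measure_display} {T : measurableType d} {R : realType}.
Variables (mu : {measure set T -> \bar R}) (E : set T).
Hypotheses (mE : measurable E) (Efin : (mu E < +oo)%E).

Local Notation m S := (fine (mu S)).

Lemma measure_sub_fin (S : set T) : measurable S -> S `<=` E ->
  mu S = (m S)%:E.
Proof.
move=> mS SE; rewrite fineK// ge0_fin_numE//.
by apply: le_lt_trans Efin; apply: le_measure; rewrite ?inE.
Qed.

Lemma fine_measure_ge0 (S : set T) : 0 <= m S.
Proof. exact: fine_ge0. Qed.

Lemma le_fine_measure (G S : set T) : measurable G -> measurable S ->
  S `<=` E -> G `<=` S -> m G <= m S.
Proof.
move=> mG mS SE GS; rewrite -lee_fin -!measure_sub_fin//.
  by apply: le_measure; rewrite ?inE.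
exact: (subset_trans _ SE).
Qed.

Lemma fine_measureD (G S : set T) : measurable G -> measurable S ->
  S `<=` E -> G `<=` S -> m (S `\` G) = m S - m G.
Proof.
move=> mG mS SE GS; apply: EFin_inj.
rewrite -measure_sub_fin//; last 2 first.
  exact: measurableD.
  by move=> x [/SE].
rewrite EFinB -!measure_sub_fin//; last exact: (subset_trans _ SE).
have Sfin : (mu S < +oo)%E by rewrite (measure_sub_fin mS)// ltry.
by rewrite measureD// setIidr.
Qed.

Lemma fine_measureU (G S : set T) : measurable G -> measurable S ->
  G `<=` E -> S `<=` E -> [disjoint G & S] -> m (G `|` S) = m G + m S.
Proof.
move=> mG mS GE SE /disj_set2P GS; apply: EFin_inj.
rewrite -measure_sub_fin//; last 2 first.
  exact: measurableU.
  by move=> x [/GE|/SE].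
by rewrite EFinD -!measure_sub_fin// measureU.
Qed.

Lemma fine_measureID (G S : set T) : measurable G -> measurable S ->
  S `<=` E -> m S = m (S `&` G) + m (S `\` G).
Proof.
move=> mG mS SE.
have -> : S `\` G = S `\` (S `&` G).
  by apply/seteqP; split=> x [Sx nG]; split=> // ; [case|move=> Gx; apply: nG].
rewrite fine_measureD//; [ring|exact: measurableI].
Qed.

Hypothesis atomless : no_atoms_in mu E.

(** Since [S] is not an atom it splits into two nonnull pieces, and the smaller piece has at most
    half the measure. *)
Lemma atomless_half (S : set T) : measurable S -> S `<=` E -> 0 < m S ->
  exists G, [/\ measurable G, G `<=` S, 0 < m G & m G <= m S / 2].
Proof.
move=> mS SE S0; apply: contrapT => H; apply: atomless.
exists S; split => //; split => //.
  by rewrite measure_sub_fin// lte_fin.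
move=> G mG GS; apply: contrapT => /not_orP[G0 SG0].
have GE : G `<=` E by exact: (subset_trans _ SE).
have mSG : measurable (S `\` G) by exact: measurableD.
have SGE : S `\` G `<=` E by move=> x [/SE].
have {}G0 : 0 < m G.
  rewrite lt_neqAle fine_measure_ge0 andbT eq_sym; apply/eqP => h; apply: G0.
  by rewrite measure_sub_fin// h.
have {}SG0 : 0 < m (S `\` G).
  rewrite lt_neqAle fine_measure_ge0 andbT eq_sym; apply/eqP => h; apply: SG0.
  by rewrite measure_sub_fin// h.
have [Gle|Ggt] := leP (m G) (m S / 2).
  by apply: H; exists G.
apply: H; exists (S `\` G); split => //; rewrite fine_measureD//; lra.
Qed.

Lemma atomless_small (S : set T) (e : R) : measurable S -> S `<=` E ->
  0 < m S -> 0 < e ->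
  exists G, [/\ measurable G, G `<=` S, 0 < m G & m G <= e].
Proof.
move=> mS SE S0 e0.
have H n : exists G, [/\ measurable G, G `<=` S, 0 < m G & m G <= m S / 2 ^+ n].
  elim: n => [|n [G [mG GS G0 Gn]]].
    by exists S; split => //; rewrite expr0 divr1.
  have [|G' [mG' G'G G'0 G'n]] := atomless_half mG _ G0.
    exact: (subset_trans _ SE).
  exists G'; split => //; first exact: (subset_trans _ GS).
  rewrite exprSr invfM mulrA (le_trans G'n)// ler_pM2r ?invr_gt0//.
have [n nP] : exists n, m S / e <= 2 ^+ n.
  have [n hn] : exists n : nat, m S / e <= n%:R.
    exists (Num.truncn (m S / e)).+1.
    by apply/ltW/truncnS_gt.
  exists n; apply: le_trans hn _.
  by rewrite -natrX ler_nat ltnW// ltn_expl.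
have [G [mG GS G0 Gn]] := H n.
exists G; split => //; apply: le_trans Gn _.
by rewrite ler_pdivrMr ?exprn_gt0// mulrC -ler_pdivrMr.
Qed.

(** Sierpinski's intermediate value theorem, by greedy exhaustion: each step gains at least half of
    the largest measure that still fits under [t]. If the union fell short of [t], a small nonnull
    [G] outside it would fit at every stage, and each step would gain at least [m G / 2], eventually
    exceeding [t]. *)
Lemma atomless_subset_measure (S : set T) (t : R) : measurable S -> S `<=` E ->
  0 <= t <= m S -> exists G, [/\ measurable G, G `<=` S & m G = t].
Proof.
move=> mS SE /andP[t0 tS].
pose ok (F : set T) := [/\ measurable F, F `<=` S & m F <= t].
(* The premise [ok F] makes the relation total, as [dependent_choice] demands. *)
pose step (F F' : set T) := ok F -> [/\ ok F', F `<=` F' &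
  forall G, measurable G -> G `<=` S `\` F -> m F + m G <= t ->
    m G <= 2 * (m F' - m F)].
have step_ex F : {F' | step F F'}.
  apply: cid; have [[mF FS Ft]|] := pselect (ok F); last by move=> nok; exists F.
  have FE : F `<=` E by exact: (subset_trans _ SE).
  pose V := [set m G | G in [set G | [/\ measurable G, G `<=` S `\` F
    & m F + m G <= t]]].
  have V0 : V 0.
    by exists set0; rewrite /= ?measure0//=; split => //; rewrite addr0.
  have Vsup : has_sup V.
    split; first by exists 0.
    exists t => _ [G [mG GS Gt] <-]; have := fine_measure_ge0 F; lra.
  have sup0 : 0 <= sup V by exact: (ub_le_sup Vsup.2).
  have [sV|sV] := leP (sup V) 0.
    exists F => _; split => // G mG GS Gt.
    rewrite subrr mulr0; apply: le_trans sV; apply: (ub_le_sup Vsup.2).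
    by exists G.
  (* The supremum need not be attained, but when positive it is attained up to a factor 2. *)
  have [|_ [G [mG GS Gt] <-] hG] := @sup_adherent _ V (sup V / 2) _ Vsup.
    lra.
  have GE : G `<=` E by move=> x /GS[/SE].
  have FG : [disjoint F & G].
    by apply/disj_set2P; rewrite -subset0 => x [Fx /GS[]].
  exists (F `|` G) => _; split.
  - split; first exact: measurableU.
      by move=> x [/FS|/GS[]].
    by rewrite fine_measureU.
  - by move=> x; left.
  - move=> G' mG' G'S G't.
    have : m G' <= sup V by apply: (ub_le_sup Vsup.2); exists G'.
    rewrite fine_measureU//; lra.
have [F [F0 FP]] := dependent_choice step_ex set0.
have okF n : ok (F n).
  elim: n => [|n IH]; last by case: (FP n IH).
  by rewrite F0; split; rewrite ?measure0.
have ndF : nondecreasing_seq F.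
  apply/nondecreasing_seqP => n; apply/subsetPset.
  by case: (FP n (okF n)).
have mFn n : measurable (F n) by case: (okF n).
have FSn n : F n `<=` S by case: (okF n).
have mUF : measurable (\bigcup_n F n) by exact: bigcupT_measurable.
have UFS : \bigcup_n F n `<=` S by move=> x [n _ /FSn].
have UFE : \bigcup_n F n `<=` E by exact: (subset_trans _ SE).
have cvgF : mu \o F @ \oo --> mu (\bigcup_n F n).
  exact: nondecreasing_cvg_mu.
have UFt : m (\bigcup_n F n) <= t.
  rewrite -lee_fin -measure_sub_fin//.
  rewrite -(cvg_lim _ cvgF)//; apply: lime_le; first by apply/cvg_ex; exists (mu (\bigcup_n F n)).
  apply: nearW => n /=; rewrite measure_sub_fin//; last exact: (subset_trans _ SE).
  by rewrite lee_fin; case: (okF n).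
have [UFlt|UFge] := ltP (m (\bigcup_n F n)) t; last first.
  by exists (\bigcup_n F n); split => //; apply/eqP; rewrite eq_le UFt.
exfalso.
have [| | | |G [mG GS G0 Gt]] := @atomless_small (S `\` \bigcup_n F n)
  (t - m (\bigcup_n F n)).
- exact: measurableD.
- by move=> x [/SE].
- rewrite fine_measureD//; lra.
- lra.
have grow n : m G <= 2 * (m (F n.+1) - m (F n)).
  case: (FP n (okF n)) => _ _; apply => //.
    by move=> x /GS[Sx nx]; split => // Fx; apply: nx; exists n.
  have : m (F n) <= m (\bigcup_n F n).
    apply: le_fine_measure => //; exact: bigcup_sup.
  lra.
have lin n : n%:R * m G <= 2 * m (F n).
  elim: n => [|n IH]; first by rewrite mul0r mulr_ge0// fine_measure_ge0.
  have := grow n; rewrite -natr1 mulrDl mul1r; lra.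
pose n := (Num.truncn (2 * t / m G)).+1.
have /= nlt := truncnS_gt (2 * t / m G).
have := lin n; rewrite -ler_pdivlMr//.
have [_ _ Fnt] := okF n.
suff : 2 * m (F n) / m G <= 2 * t / m G by rewrite -/n in nlt *; lra.
by rewrite ler_pM2r ?invr_gt0// ler_pM2l.
Qed.

(** By induction on the list, the parts of [S] inside and outside the first set [Q] are halved
    separately; the union of the two halves then halves [Q] as well, and the later sets by
    additivity. *)
Lemma atomless_halve_list (L : seq (set T)) (S : set T) :
  (forall Q, Q \in L -> measurable Q) -> measurable S -> S `<=` E ->
  exists B, [/\ measurable B, B `<=` S, m B = m S / 2 &
    forall Q, Q \in L -> m (B `&` Q) = m (S `&` Q) / 2].
Proof.
elim: L S => [|Q L IH] S mL mS SE.
  have [|B [mB BS Bt]] := @atomless_subset_measure S (m S / 2) mS SE.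
    have := fine_measure_ge0 S; lra.
  by exists B; split.
have mQ : measurable Q by apply: mL; rewrite inE eqxx.
have {}mL Q' : Q' \in L -> measurable Q'.
  by move=> Q'L; apply: mL; rewrite inE Q'L orbT.
have [| |B1 [mB1 B1S B1m B1L]] := IH (S `&` Q) mL.
- exact: measurableI.
- by move=> x [/SE].
have [| |B2 [mB2 B2S B2m B2L]] := IH (S `\` Q) mL.
- exact: measurableD.
- by move=> x [/SE].
have B1E : B1 `<=` E by move=> x /B1S[/SE].
have B2E : B2 `<=` E by move=> x /B2S[/SE].
have B12 : [disjoint B1 & B2].
  by apply/disj_set2P; rewrite -subset0 => x [/B1S[_ Qx] /B2S[_ /(_ Qx)]].
exists (B1 `|` B2); split.
- exact: measurableU.
- by move=> x [/B1S[]|/B2S[]].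
- rewrite fine_measureU// B1m B2m (fine_measureID mQ mS SE); lra.
move=> Q'; rewrite inE => /predU1P[->|Q'L].
  have -> : (B1 `|` B2) `&` Q = B1.
    apply/seteqP; split=> [x [[//|/B2S[_ nQ] /nQ//]]|x B1x].
    by split; [left|case: (B1S _ B1x)].
  by rewrite B1m.
have mQ' := mL _ Q'L.
rewrite setIUl fine_measureU; try exact: measurableI.
- rewrite B1L// B2L// -mulrDl; congr (_ / 2).
  rewrite (@fine_measureID Q (S `&` Q'))//; last 2 first.
    exact: measurableI.
    by move=> x [/SE].
  congr (m _ + m _); apply/seteqP; split=> x /=; tauto.
- by move=> x [/B1E].
- by move=> x [/B2E].
- apply/disj_set2P; rewrite -subset0 => x [[B1x _] [B2x _]].
  by move/disj_set2P: B12; rewrite -subset0 => /(_ x); apply.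
Qed.

(* Each term halves every cell cut out by the previous ones, so that its
symmetric difference with each of them has measure [m S / 2]. *)
Lemma atomless_rademacher (S : set T) : measurable S -> S `<=` E ->
  exists B : nat -> set T,
    (forall n, [/\ measurable (B n), B n `<=` S & m (B n) = m S / 2]) /\
    (forall n k, (n < k)%N -> m (B n `\` B k `|` B k `\` B n) = m S / 2).
Proof.
move=> mS SE.
pose good B := [/\ measurable B, B `<=` S & m B = m S / 2].
pose ok (L : seq (set T)) := forall Q, Q \in L -> good Q.
(* The state of the recursion is the list of all sets chosen so far, latest first, because the next
   set has to halve each of them. *)
pose step (L L' : seq (set T)) := ok L -> exists B, [/\ L' = B :: L, good B &
  forall Q, Q \in L -> m (B `&` Q) = m (S `&` Q) / 2].
have step_ex L : {L' | step L L'}.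
  apply: cid; have [okL|] := pselect (ok L); last by move=> nok; exists L.
  have [|B [mB BS Bm BL]] := @atomless_halve_list L S _ mS SE.
    by move=> Q /okL[].
  by exists (B :: L) => _; exists B.
have [L [L0 LP]] := dependent_choice step_ex [::].
have okL n : ok (L n).
  elim: n => [|n IH]; first by rewrite L0 => Q; rewrite in_nil.
  have [B [-> gB _]] := LP n IH.
  by move=> Q; rewrite inE => /predU1P[->//|/IH].
pose B n := head set0 (L n.+1).
have LB n : L n.+1 = B n :: L n.
  by rewrite /B; have [C [-> _ _]] := LP n (okL n).
have BL n k : (n < k)%N -> B n \in L k.
  elim: k => // k IH; rewrite ltnS leq_eqVlt LB inE => /predU1P[->|/IH ->].
    by rewrite eqxx.
  by rewrite orbT.
have gB n : good (B n) by apply: (okL n.+1); exact: BL.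
exists B; split => // n k nk.
have [mn nS hn] := gB n; have [mk kS hk] := gB k.
(* The intersection has measure [m S / 4], hence so has each of the two differences. *)
have : m (B k `&` B n) = m (B n) / 2.
  have [C [eC _ +]] := LP k (okL k); move: eC; rewrite LB => -[<-].
  by move=> /(_ _ (BL _ _ nk)) ->; rewrite setIidr.
have nE : B n `<=` E by exact: (subset_trans _ SE).
have kE : B k `<=` E by exact: (subset_trans _ SE).
have := fine_measureID mk mn nE; have := fine_measureID mn mk kE.
rewrite fine_measureU; last 5 first.
- exact: measurableD.
- exact: measurableD.
- by move=> x [/nE].
- by move=> x [/kE].
- by apply/disj_set2P; rewrite -subset0 => x [[_ +] [+ _]].
rewrite hn hk (setIC (B n)); lra.
Qed.

Lemma atomless_shrinking (S : set T) : measurable S -> S `<=` E ->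
  exists V : nat -> set T, forall n,
    [/\ measurable (V n), V n `<=` S & m (V n) = m S / 2 ^+ n].
Proof.
move=> mS SE.
suff H n : {G | [/\ measurable G, G `<=` S & m G = m S / 2 ^+ n]}.
  by exists (fun n => sval (H n)) => n; exact: (svalP (H n)).
apply: cid; apply: atomless_subset_measure => //.
rewrite divr_ge0 ?fine_measure_ge0 ?exprn_ge0//=.
rewrite ler_pdivrMr ?exprn_gt0// ler_peMr ?fine_measure_ge0//.
by rewrite exprn_ege1// ler1n.
Qed.

End FiniteAtomless.

(** * Common thresholds *)

(** Basic weak and Mackey neighbourhoods, like finite subcovers, come as families indexed by
    [i < n]; this merges their thresholds into one. *)
Lemma eventually_finite (n : nat) (P : nat -> nat -> Prop) :
  (forall i, (i < n)%N -> exists N, forall k, (N <= k)%N -> P i k) ->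
  exists N, forall k, (N <= k)%N -> forall i, (i < n)%N -> P i k.
Proof.
elim: n => [|n IH] H; first by exists 0%N.
have [i lin|N hN] := IH; first by apply: H; rewrite ltnW.
have [N' hN'] := H n (ltnSn n).
exists (maxn N N') => k; rewrite geq_max => /andP[Nk N'k] i.
by rewrite ltnS leq_eqVlt => /predU1P[->|]; [exact: hN'|exact: hN].
Qed.

Lemma near_invSn {R : realType} {e : R} : 0 < e ->
  exists N : nat, forall k, (N <= k)%N -> k.+1%:R^-1 < e.
Proof.
move=> e0; exists (Num.truncn e^-1) => k Nk.
rewrite invf_plt ?posrE//; apply: lt_le_trans (truncnS_gt _) _.
by rewrite ler_nat.
Qed.

(** * The pairing, absolute continuity of integrals, and weak cluster points *)

Section Pairing.
Set Implicit Arguments. Unset Strict Implicit.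
Context {d : measure_display} {T : measurableType d} {R : realType}.
Variable mu : {measure set T -> \bar R}.
Implicit Types (f g h : T -> R) (S Q : set T) (K : set (T -> R)).

Lemma Linf_indic S : measurable S -> Linf mu \1_S.
Proof.
move=> mS; split; first exact: measurable_indic.
exists 1; apply: aeW => x; rewrite indicE.
by case: (x \in S); rewrite ?normr0 ?normr1.
Qed.

Lemma pairing_integrable f g : Linf mu f -> L1 mu g ->
  mu.-integrable setT (EFin \o (f \* g)).
Proof.
move=> [mf [M fM]] g1; have mg : measurable_fun setT g.
  by apply/measurable_EFinP; exact: (measurable_int mu).
have mfg : measurable_fun setT (f \* g) by exact: measurable_funM.
apply/integrableP; split; first exact/measurable_EFinP.
have gM : mu.-integrable setT (fun x => `|M|%:E * (EFin \o g) x)%E.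
  exact: integrableZl.
have /integrableP[mgM] := gM; apply: le_lt_trans.
apply: ae_ge0_le_integral => //.
- by do 2 apply: measurableT_comp => //.
- exact: measurableT_comp.
- move: fM; apply: filterS => x fxM _ /=.
  rewrite lee_fin !normrM normr_id ler_wpM2r//.
  exact: le_trans fxM (ler_norm _).
Qed.

Lemma pairingB f g h : Linf mu f -> L1 mu g -> L1 mu h ->
  pairing mu f (g \- h) = pairing mu f g - pairing mu f h.
Proof.
move=> f1 g1 h1; rewrite /pairing -!/(Rintegral mu setT _).
rewrite -RintegralB//; try exact: pairing_integrable.
by apply: eq_Rintegral => x _ /=; rewrite mulrBr.
Qed.

Lemma pairing_indic S g : pairing mu \1_S g = \int[mu]_(x in S) g x.
Proof.
rewrite Rintegral_mkcond; apply: eq_Rintegral => x _.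
by rewrite patch_indic /= mulrC.
Qed.

Lemma L1_integrable S g : measurable S -> L1 mu g ->
  mu.-integrable S (EFin \o g).
Proof. by move=> mS; apply: integrableS. Qed.

Lemma L1_integrable_norm S g : measurable S -> L1 mu g ->
  mu.-integrable S (EFin \o (fun x => `|g x|)).
Proof. by move=> mS g1; apply: integrable_norm; exact: L1_integrable. Qed.

Lemma norm_Rintegral_le S Q g : measurable S -> measurable Q -> S `<=` Q ->
  L1 mu g -> `|\int[mu]_(x in S) g x| <= \int[mu]_(x in Q) `|g x|.
Proof.
move=> mS mQ SQ g1.
apply: le_trans (le_normr_Rintegral mS (L1_integrable mS g1)) _.
rewrite /Rintegral fine_le//; last 1 first.
- apply: ge0_subset_integral => //; apply: (measurable_int mu).
  exact: L1_integrable_norm.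
- by apply: integrable_fin_num => //; exact: L1_integrable_norm.
- by apply: integrable_fin_num => //; exact: L1_integrable_norm.
Qed.

Lemma Rintegral_setID S Q g : measurable S -> measurable Q -> L1 mu g ->
  \int[mu]_(x in S) g x =
  \int[mu]_(x in S `&` Q) g x + \int[mu]_(x in S `\` Q) g x.
Proof.
move=> mS mQ g1; rewrite -Rintegral_setU.
- by rewrite setUIDK.
- exact: measurableI.
- exact: measurableD.
- by rewrite setUIDK; exact: L1_integrable.
- by apply/disj_set2P; rewrite -subset0 => x [[_ Qx] [_ /(_ Qx)]].
Qed.

(** The sets decrease to a null set, so [|g|] restricted to [S n] is eventually zero at almost every
    point, and dominated convergence with bound [|g|] applies. *)
Lemma Rintegral_shrinking (S : nat -> set T) g :
  (forall n, measurable (S n)) -> (forall n k, (n <= k)%N -> S k `<=` S n) ->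
  (forall n, (mu (S n) <= (2 ^- n)%:E)%E) -> L1 mu g ->
  forall e, 0 < e -> exists N, forall n, (N <= n)%N ->
    \int[mu]_(x in S n) `|g x| < e.
Proof.
move=> mS ndS Sle g1 e e0.
have mg : measurable_fun setT g.
  by apply/measurable_EFinP; exact: (measurable_int mu).
pose u n x : \bar R := (((fun x => `|g x|) \_ (S n)) x)%:E.
have mu0 : mu (\bigcap_n S n) = 0%E.
  apply/eqP; rewrite -measure_le0; apply/lee_addgt0Pr => r r0; rewrite add0e.
  have [N hN] := near_invSn r0.
  apply: (@le_trans _ _ (mu (S N))).
    apply: le_measure; rewrite ?inE//; last by move=> x; apply.
    exact: bigcapT_measurable.
  apply: le_trans (Sle N) _; rewrite lee_fin ltW//.
  apply: le_lt_trans (hN N (leqnn _)).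
  by rewrite lef_pV2 ?posrE// ?exprn_gt0// -natrX ler_nat ltn_expl.
have [|||||_ _] := @dominated_convergence _ _ _ mu setT measurableT u (cst 0%E)
  (EFin \o (fun x => `|g x|)) => //.
- move=> n; apply/measurable_EFinP; apply/measurable_restrict => //.
  by rewrite setTI; apply: measurable_funTS; exact: measurableT_comp.
- exists (\bigcap_n S n); split => //; first exact: bigcapT_measurable.
  move=> x /= H n _; apply: contrapT => nS; apply: H => _.
  apply: cvg_near_cst; exists n => // k /= nk.
  rewrite /u patchE ifF//; apply/negbTE; rewrite notin_setE => Skx.
  by apply: nS; exact: ndS Skx.
- exact: L1_integrable_norm.
- apply: aeW => x n _ /=; rewrite /u lee_fin patchE; case: ifPn => //.
    by rewrite normr_id.
  by rewrite normr0.
rewrite integral0 => /fine_cvgP[_] /cvgrPdist_lt /(_ _ e0)[N _ hN].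
exists N => n /hN /=; rewrite sub0r normrN.
rewrite Rintegral_mkcond; apply: le_lt_trans.
exact: ler_norm.
Qed.

(** The coefficients [s / 2] and [- s / 2] have absolute values adding up to 1. The sign [s] serves
    to make a chosen integral positive. *)
Lemma abs_convex_half K g h (s : R) : abs_convex K -> K g -> K h ->
  `|s| = 1 -> K (fun x => s / 2 * (g x - h x)).
Proof.
move=> cK Kg Kh s1.
have -> : (fun x => s / 2 * (g x - h x)) =
          (fun x => s / 2 * g x + (- (s / 2)) * h x).
  by apply/funext => x; ring.
apply: cK => //; rewrite normrN.
have -> : `|s / 2| = 2^-1 by rewrite normrM s1 mul1r ger0_norm.
lra.
Qed.

Lemma weak_open_ball (n : nat) (fs : nat -> T -> R) g (e : R) :
  (forall i, (i < n)%N -> Linf mu (fs i)) -> L1 mu g ->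
  weak_open mu [set h | L1 mu h /\
    forall i, (i < n)%N -> `|pairing mu (fs i) (h \- g)| < e].
Proof.
move=> fsL g1; split; first by move=> h [].
move=> g' [g'1 g'e].
(* Each of the [n] strict inequalities at [g'] leaves some slack; a single radius [1 / (N + 1)] fits
   into all of them. *)
have [|N hN] := @eventually_finite n
    (fun i k => `|pairing mu (fs i) (g' \- g)| + k.+1%:R^-1 < e).
  move=> i lin; have : 0 < e - `|pairing mu (fs i) (g' \- g)|.
    by rewrite subr_gt0 g'e.
  move=> /near_invSn[N hN]; by exists N => k /hN; rewrite ltrBrDl.
exists n, fs, N.+1%:R^-1; split => // h h1 hlt; split => // i lin.
have /= := hN N (leqnn _) i lin; have := hlt i lin.
rewrite !pairingB//; try exact: fsL.
set a := pairing _ _ h; set b := pairing _ _ g; set c := pairing _ _ g'.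
move=> ac cb; apply: le_lt_trans (ler_distD c a b) _.
by apply: lt_trans cb; rewrite addrC ltrD2l.
Qed.

(** If no point of [K] were a cluster point, each would have a weak neighbourhood that the sequence
    eventually avoids; finitely many of these cover [K], so the sequence would eventually avoid
    [K]. *)
Lemma weak_compact_cluster K (gs : nat -> T -> R) : weak_compact mu K ->
  (forall n, K (gs n)) ->
  exists2 g, K g & forall (n : nat) (fs : nat -> T -> R) (e : R) (k0 : nat),
    (forall i, (i < n)%N -> Linf mu (fs i)) -> 0 < e ->
    exists2 k, (k0 <= k)%N & forall i, (i < n)%N ->
      `|pairing mu (fs i) (gs k \- g)| < e.
Proof.
move=> [K1 Kc] Kgs; apply: contrapT => H.
pose C := [set W | weak_open mu W /\
  exists k0, forall k, (k0 <= k)%N -> ~ W (gs k)].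
have [W []//|h Kh|n [Ws [WsC Wscov]]] := Kc C.
  apply: contrapT => nW; apply: H; exists h => // n fs e k0 fsL e0.
  apply: contrapT => nk; apply: nW.
  exists [set g | L1 mu g /\
    forall i, (i < n)%N -> `|pairing mu (fs i) (g \- h)| < e]; split.
    split; first by apply: weak_open_ball => //; exact: K1.
    exists k0 => k k0k [_ Hk]; apply: nk; by exists k.
  split; first exact: K1.
  move=> i lin; rewrite pairingB; [|exact: fsL|exact: K1|exact: K1].
  by rewrite subrr normr0.
have [|N hN] := @eventually_finite n (fun i k => ~ Ws i (gs k)).
  by move=> i /WsC[].
have [i [lin Wi]] := Wscov _ (Kgs N).
exact: (hN N (leqnn _) i lin).
Qed.

(** Indicators are the only test functions that the gliding hump argument needs. *)
Lemma weak_compact_cluster_sets K (gs : nat -> T -> R) : weak_compact mu K ->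
  (forall n, K (gs n)) ->
  exists2 g, K g & forall (L : seq (set T)) (e : R) (k0 : nat),
    (forall Q, Q \in L -> measurable Q) -> 0 < e ->
    exists2 k, (k0 <= k)%N & forall Q, Q \in L ->
      `|\int[mu]_(x in Q) gs k x - \int[mu]_(x in Q) g x| < e.
Proof.
move=> wK Kgs; have [g Kg gP] := weak_compact_cluster wK Kgs.
exists g => // L e k0 mL e0.
have LL i : (i < size L)%N -> Linf mu \1_(nth set0 L i).
  by move=> iL; apply: Linf_indic; apply: mL; exact: mem_nth.
have [k k0k kP] := gP (size L) (fun i => \1_(nth set0 L i)) e k0 LL e0.
exists k => // Q QL; rewrite -!pairing_indic -pairingB; last 3 first.
- by apply: Linf_indic; exact: mL.
- exact: wK.1.
- exact: wK.1.
by rewrite -(nth_index set0 QL); apply: kP; rewrite index_mem.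
Qed.

End Pairing.

(** * Uniform integrability of absolutely convex weakly compact sets *)

Section UniformIntegrability.
Set Implicit Arguments. Unset Strict Implicit.
Context {d : measure_display} {T : measurableType d} {R : realType}.
Variable mu : {measure set T -> \bar R}.
Implicit Types (f g h : T -> R) (S Q : set T).
Variable K : set (T -> R).
Hypotheses (cK : abs_convex K) (wK : weak_compact mu K).

Local Notation I S g := (\int[mu]_(x in S) g x).

Let K1 g : K g -> L1 mu g. Proof. exact: wK.1. Qed.

Lemma Rintegral_half_diff S g h (s : R) : measurable S -> K g -> K h ->
  I S (fun x => s / 2 * (g x - h x)) = s / 2 * (I S g - I S h).
Proof.
move=> mS Kg Kh; rewrite RintegralZl//.
  by rewrite RintegralB//; apply: L1_integrable => //; exact: K1.
apply: (integrableB _ (f := EFin \o g) (g := EFin \o h)) => //;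
  by apply: L1_integrable => //; exact: K1.
Qed.

(* Subtracting a weak cluster point makes the bumps [h] asymptotically
orthogonal to any finite list of indicators. *)
Lemma gliding_bump (A S : nat -> set T) (gs : nat -> T -> R) (e : R) :
  0 < e -> (forall n, measurable (A n)) -> (forall n, measurable (S n)) ->
  (forall n, A n `<=` S n) -> (forall n k, (n <= k)%N -> S k `<=` S n) ->
  (forall n, (mu (S n) <= (2 ^- n)%:E)%E) ->
  (forall n, K (gs n)) -> (forall n, e <= `|I (A n) (gs n)|) ->
  forall (L : seq (set T)) (q : nat) (r : R),
  (forall Q, Q \in L -> measurable Q) -> 0 < r ->
  exists k h, [/\ (q <= k)%N, K h, e / 4 <= I (A k) h &
    forall Q, Q \in L -> `|I Q h| < r].
Proof.
move=> e0 mA mS AS ndS Sle Kgs gsA L q r mL r0.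
have [g Kg gcl] := weak_compact_cluster_sets wK Kgs.
have e2 : 0 < e / 2 by lra.
have [N hN] := Rintegral_shrinking mS ndS Sle (K1 Kg) e2.
have [k qk kP] := gcl L r (maxn q N) mL r0.
move: qk; rewrite geq_max => /andP[qk Nk].
have IAg : `|I (A k) g| < e / 2.
  apply: le_lt_trans (hN _ Nk); apply: norm_Rintegral_le => //.
  exact: K1.
have big : e / 2 <= `|I (A k) (gs k) - I (A k) g|.
  have := lerB_normD (I (A k) (gs k)) (- I (A k) g).
  rewrite normrN; have := gsA k.
  move: (`|I (A k) (gs k)|) (`|I (A k) g|) IAg => a b; lra.
(* The integral of [gs k - g] over [A k] is at least [e / 2] in absolute value; this sign together
   with the factor 1/2 turns it into a value of at least [e / 4]. *)
pose s : R := if 0 <= I (A k) (gs k) - I (A k) g then 1 else -1.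
have s1 : `|s| = 1 by rewrite /s; case: ifP; rewrite ?normrN normr1.
exists k, (fun x => s / 2 * (gs k x - g x)); split => //.
- exact: abs_convex_half.
- rewrite Rintegral_half_diff//.
  move: big; rewrite /s; set a := _ - _; case: (leP 0 a) => a0.
    rewrite ger0_norm//; lra.
  rewrite ltr0_norm//; lra.
- move=> Q QL; rewrite Rintegral_half_diff//; last exact: mL.
  rewrite 2!normrM s1 mul1r ger0_norm//.
  have := kP Q QL; have : 0 <= `|I Q (gs k) - I Q g| by [].
  move: (`|_|) => a;
  lra.
Qed.

(** Increasing sets [Q n] and bumps [h n] in [K] are built so that [h n] has a large integral over
    [Q n] but small integrals over all earlier ones. With [P] the union, all integrals of [h n] over
    [P] are large. A weak cluster point [g] inherits a large integral over [P] and small ones over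
    every [Q N], although its integral over the rest of [P] tends to 0. *)
Lemma no_gliding_hump (A S : nat -> set T) (gs : nat -> T -> R) (e : R) :
  0 < e -> (forall n, measurable (A n)) -> (forall n, measurable (S n)) ->
  (forall n, A n `<=` S n) -> (forall n k, (n <= k)%N -> S k `<=` S n) ->
  (forall n, (mu (S n) <= (2 ^- n)%:E)%E) ->
  (forall n, K (gs n)) -> ~ (forall n, e <= `|I (A n) (gs n)|).
Proof.
move=> e0 mA mS AS ndS Sle Kgs gsA.
(* A bump starts with integral [e / 4 = 8 * r]; the errors reduce this to [6 * r] on [Q n] and
   [5 * r] on [P], still enough for the final comparison. *)
pose r := e / 32; have r0 : 0 < r by rewrite /r; lra.
have bump := gliding_bump e0 mA mS AS ndS Sle Kgs gsA.
pose hd (L : seq (set T)) := head set0 L.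
(* A state holds the sets [Q] so far, latest first, an index [q] such that the latest [Q] misses
   [S q], and the latest bump. *)
pose state : Type := (seq (set T) * nat * (T -> R))%type.
pose ok (s : state) := (forall Q, Q \in s.1.1 -> measurable Q) /\
  (forall x, hd s.1.1 x -> ~ S s.1.2 x).
(* The new bump lives mainly on [A k]. Removing [S] at the new index from [A k] costs little
   integral and leaves room for all later sets. *)
pose next (s s' : state) := exists k, [/\ (s.1.2 <= k < s'.1.2)%N,
   s'.1.1 = (hd s.1.1 `|` (A k `\` S s'.1.2)) :: s.1.1, K s'.2,
   8 * r <= I (A k) s'.2 & (forall Q, Q \in s.1.1 -> `|I Q s'.2| < r) /\
    I (S s'.1.2) (fun x => `|s'.2 x|) < r].
have hdmeas s : ok s -> measurable (hd s.1.1).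
  move=> [mL _]; rewrite /hd; case: (s.1.1) mL => //= Q L; apply.
  by rewrite inE eqxx.
have next_ok s s' : ok s -> next s s' -> ok s'.
  move=> oks [k [/andP[sk ks'] Ls' _ _ _]].
  have mhd := hdmeas _ oks; case: oks => mL dL; split.
    move=> Q; rewrite Ls' inE => /predU1P[->|/mL//].
    by apply: measurableU => //; exact: measurableD.
  rewrite Ls' /= => x [hx|[]//] Sx; apply: (dL _ hx).
  by apply: ndS Sx; rewrite ltnW// (leq_ltn_trans sk).
have next_ex s : {s' | ok s -> next s s'}.
  apply: cid; have [oks|] := pselect (ok s); last by move=> nok; exists s.
  have [k [h [qk Kh bk hL]]] := bump s.1.1 s.1.2 r oks.1 r0.
  have [N hN] := Rintegral_shrinking mS ndS Sle (K1 Kh) r0.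
  (* The new index is large enough for the tail of [h] to be small, and exceeds [k], so indices
     strictly increase. *)
  exists ((hd s.1.1 `|` (A k `\` S (maxn N k.+1))) :: s.1.1, maxn N k.+1, h).
  move=> _; exists k; split => //=.
  - by rewrite qk leq_maxr.
  - by apply: le_trans bk; rewrite /r; lra.
  - by split => //; apply: hN; exact: leq_maxl.
(* The bump in the initial state is a placeholder: bumps are read off from [s n.+1]. *)
have [s [s0 sP]] := dependent_choice next_ex ([::], 0%N, gs 0%N).
have oks n : ok (s n).
  elim: n => [|n IH]; first by rewrite s0; split.
  exact: next_ok IH (sP n IH).
have {}sP n : next (s n) (s n.+1) by exact: sP.
pose Q n := hd (s n.+1).1.1; pose q n := (s n.+1).1.2; pose h n := (s n.+1).2.
have sQ n : (s n.+1).1.1 = Q n :: (s n).1.1.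
  by rewrite /Q; have [k [_ -> _ _ _]] := sP n.
have mQ n : measurable (Q n) by apply: hdmeas; exact: oks.
have Kh n : K (h n) by have [k []] := sP n.
have qmono n k : (n <= k)%N -> (q n <= q k)%N.
  move=> /subnK <-; elim: (k - n)%N => // i; rewrite addSn => /leq_trans; apply.
  by rewrite /q; have [j [/andP[jl jr] _ _ _ _]] := sP (i + n).+1;
    rewrite (leq_trans jl)// ltnW.
have qge n : (n <= q n)%N.
  elim: n => // n IH; apply: leq_ltn_trans IH _.
  by rewrite /q; have [j [/andP[jl jr] _ _ _ _]] := sP n.+1;
    rewrite (leq_ltn_trans jl).
have memQ j n : (j < n)%N -> Q j \in (s n).1.1.
  elim: n => // n IH; rewrite ltnS leq_eqVlt sQ inE => /predU1P[->|/IH ->].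
    by rewrite eqxx.
  by rewrite orbT.
have hQ j n : (j < n)%N -> `|I (Q j) (h n)| < r.
  by move=> jn; have [k [_ _ _ _ [+ _]]] := sP n; apply; exact: memQ.
have hS n : I (S (q n)) (fun x => `|h n x|) < r.
  by have [k [_ _ _ _ [_ +]]] := sP n.
have hQn n : 6 * r <= I (Q n) (h n).
  have [k [/andP[qk kq] Ls _ bk [hL hSq]]] := sP n.
  have mhd := hdmeas _ (oks n).
  rewrite /Q Ls /= Rintegral_setU//; first last.
  - apply/disj_set2P; rewrite -subset0 => x [hx [Akx _]].
    by apply: (oks n).2 hx _; apply: (ndS _ _ qk); exact: AS.
  - by apply: L1_integrable; [apply: measurableU => //; exact: measurableD|
      exact: K1 (Kh n)].
  - exact: measurableD.
  have hhd : `|I (hd (s n).1.1) (s n.+1).2| < r.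
    rewrite /hd; case: ((s n).1.1) hL => [|Q' L'] hL /=.
      by rewrite Rintegral_set0 normr0.
    by apply: hL; rewrite inE eqxx.
  have hAS : `|I (A k `&` S (s n.+1).1.2) (s n.+1).2| < r.
    apply: le_lt_trans hSq; apply: norm_Rintegral_le => //.
      exact: measurableI.
    exact: K1 (Kh n).
  move: bk; rewrite (Rintegral_setID (mA k) (mS (s n.+1).1.2) (K1 (Kh n))).
  rewrite /h; move: hhd hAS; rewrite !ltr_norml => /andP[? ?] /andP[? ?].
  rewrite /h; lra.
pose P := \bigcup_n Q n.
have mP : measurable P by exact: bigcupT_measurable.
have QS n k : (n <= k)%N -> Q k `<=` Q n `|` S (q n).
  move=> /subnK <-; elim: (k - n)%N => [|i IH]; first by move=> x; left.
  rewrite addSn /Q; have [j [/andP[jl jr] -> _ _ _]] := sP (i + n).+1.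
  move=> x /= [/IH//|[/AS Sx _]]; right; apply: ndS Sx.
  by apply: leq_trans jl; apply: qmono; exact: leq_addl.
have ndQ n k : (n <= k)%N -> Q n `<=` Q k.
  move=> /subnK <-; elim: (k - n)%N => // i IH x /IH Qx.
  rewrite addSn /Q; have [j [_ -> _ _ _]] := sP (i + n).+1.
  by rewrite /=; left.
have PQ n : P `\` Q n `<=` S (q n).
  move=> x [[k _ Qk] nQ]; have [/QS H|/ltnW/ndQ H] := leqP n k.
    by case: (H _ Qk).
  by case: nQ; exact: H.
have QP n : Q n `<=` P by move=> x Qx; exists n.
have splitP n g : K g -> I P g = I (Q n) g + I (P `\` Q n) g.
  move=> Kg; rewrite (Rintegral_setID mP (mQ n) (K1 Kg)); congr (I _ g + _).
  exact: setIidr.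
have tail n g : K g -> `|I (P `\` Q n) g| <= I (S (q n)) (fun x => `|g x|).
  move=> Kg; apply: norm_Rintegral_le => //; last exact: K1.
  exact: measurableD.
have hP n : 5 * r <= I P (h n).
  rewrite (splitP n)//; have := hQn n; have := le_lt_trans (tail n _ (Kh n)) (hS n).
  rewrite ltr_norml => /andP[? ?]; lra.
have [g Kg gcl] := weak_compact_cluster_sets wK Kh.
(* [N] depends on [g] alone. A later bump close to [g] on both [Q N] and [P] makes the integral of
   [g] over [P] larger than [4 * r], but also smaller than [2 * r] on [Q N] plus [r] on the rest. *)
have [N hN] := Rintegral_shrinking mS ndS Sle (K1 Kg) r0.
have [|k Nk kP] := gcl [:: Q N; P] r N.+1 _ r0.
  by move=> Q'; rewrite !inE => /orP[/eqP ->|/eqP ->].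
have := kP (Q N); rewrite !inE eqxx => /(_ isT).
have := kP P; rewrite !inE eqxx orbT => /(_ isT).
have := hQ N k Nk; have := hP k.
have := le_lt_trans (tail N _ Kg) (hN _ (qge N)).
rewrite (splitP N g Kg) !ltr_norml.
by move=> /andP[? ?] ? /andP[? ?] /andP[? ?] /andP[? ?]; lra.
Qed.

(** Failure yields sets [A n] of measure below [2 ^- n.+1] with integrals of size at least [e]; the
    unions [S n] of their tails have measure at most [2 ^- n], which is the excluded gliding
    hump. *)
Lemma weak_compact_uniform_integral (e : R) : 0 < e ->
  exists2 r : R, 0 < r & forall S, measurable S -> (mu S < r%:E)%E ->
    forall g, K g -> `|I S g| < e.
Proof.
move=> e0; apply: contrapT => H.
have bad n : {Ag : set T * (T -> R) | [/\ measurable Ag.1,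
    (mu Ag.1 < (2 ^- n.+1)%:E)%E, K Ag.2 & e <= `|I Ag.1 Ag.2|]}.
  apply: cid; apply: contrapT => nAg; apply: H.
  exists (2 ^- n.+1); first by rewrite invr_gt0 exprn_gt0.
  move=> S mS Slt g Kg; rewrite ltNge; apply/negP => ge; apply: nAg.
  by exists (S, g).
pose A n := (sval (bad n)).1; pose gs n := (sval (bad n)).2.
have mA n : measurable (A n) by case: (svalP (bad n)).
pose S n := \bigcup_k A (k + n)%N.
have mS n : measurable (S n) by apply: bigcupT_measurable => k; exact: mA.
apply: (@no_gliding_hump A S gs e) => //.
- by move=> n x Ax; exists 0%N.
- move=> n k /subnK <- x [i _ Aix]; exists (i + (k - n))%N => //.
  by rewrite -addnA.
- move=> n; apply: le_trans (measure_sigma_subadditive _ _ _ (@subset_refl _ _)) _ => //.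
    exact: mS.
  apply: le_trans (epsilon_trick0 xpredT _); last first.
    by rewrite invr_ge0 exprn_ge0.
  apply: lee_nneseries => // i _ /=.
  case: (svalP (bad (i + n)%N)) => _ /ltW + _ _; move=> /le_trans; apply.
  by rewrite lee_fin natrX -invfM -exprD addnS addnC.
- by move=> n; case: (svalP (bad n)).
- by move=> n; case: (svalP (bad n)).
Qed.

Variable E : set T.
Hypotheses (mE : measurable E) (Efin : (mu E < +oo)%E)
  (atomless : no_atoms_in mu E).

(** Sets of measure below [r] have integrals below 1. By atomlessness a set of measure below
    [r * 2 ^+ n] can be halved [n] times into such sets, so its integral is at most [2 ^+ n]; one
    [n] serves all subsets of [E]. *)
Lemma weak_compact_bounded : exists2 M : R, 0 < M &
  forall S, measurable S -> S `<=` E -> forall g, K g -> `|I S g| <= M.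
Proof.
have [r r0 rP] := weak_compact_uniform_integral ltr01.
have H n : forall S, measurable S -> S `<=` E -> fine (mu S) < r * 2 ^+ n ->
    forall g, K g -> `|I S g| <= 2 ^+ n.
  elim: n => [|n IH] S mS SE Sr g Kg.
    rewrite ltW// expr0; apply: rP => //.
    by rewrite (measure_sub_fin mE Efin)// lte_fin -[r]mulr1.
  have [|G [mG GS Gm]] := @atomless_subset_measure _ _ _ mu E mE Efin atomless
      S (fine (mu S) / 2) mS SE.
    have := fine_measure_ge0 mu S; lra.
  have GE : G `<=` E by exact: (subset_trans GS SE).
  have mSG : measurable (S `\` G) by exact: measurableD.
  have IG : `|I G g| <= 2 ^+ n.
    by apply: IH => //; rewrite Gm; move: Sr; rewrite exprS; lra.
  have ISG : `|I (S `\` G) g| <= 2 ^+ n.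
    apply: IH => //; first by move=> x [/SE].
    rewrite (fine_measureD mE Efin)// Gm; move: Sr; rewrite exprS; lra.
  rewrite (Rintegral_setID mS mG (K1 Kg)) (setIidr GS).
  by rewrite exprS; have := ler_normD (I G g) (I (S `\` G) g); lra.
pose n := (Num.truncn (fine (mu E) / r)).+1.
exists (2 ^+ n); first by rewrite exprn_gt0.
move=> S mS SE; apply: (H n S mS SE).
rewrite mulrC -ltr_pdivrMr//.
have : n%:R < 2 ^+ n :> R by rewrite -natrX ltr_nat ltn_expl.
apply: lt_trans; apply: le_lt_trans (truncnS_gt _).
by rewrite ler_pM2r ?invr_gt0// (le_fine_measure mE Efin).
Qed.

End UniformIntegrability.

(** * Almost everywhere order on bounded functions *)

Section OrderClosed.
Set Implicit Arguments. Unset Strict Implicit.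
Context {d : measure_display} {T : measurableType d} {R : realType}.
Variable mu : {measure set T -> \bar R}.
Implicit Types (f g h x y z : T -> R) (S Q : set T).

Lemma aeI (P Q : T -> Prop) : {ae mu, forall t, P t} ->
  {ae mu, forall t, Q t} -> {ae mu, forall t, P t /\ Q t}.
Proof. by apply: filterS2. Qed.

Lemma ae_not_measure0 S : measurable S -> {ae mu, forall t, ~ S t} ->
  mu S = 0%E.
Proof.
move=> mS H; apply/negligibleP => //; apply: negligibleS H => t St.
by move=> /(_ St).
Qed.

Lemma le_measure_ae S Q : measurable S -> measurable Q ->
  {ae mu, forall t, S t -> Q t} -> (mu S <= mu Q)%E.
Proof.
move=> mS mQ SQ; have mSQ : measurable (S `\` Q) by exact: measurableD.
have SQ0 : mu (S `\` Q) = 0%E.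
  apply: ae_not_measure0 => //; apply: filterS SQ => t SQt [St].
  by apply; exact: SQt.
rewrite -[X in (mu X <= _)%E](setUIDK S Q) measureU//; first last.
- by rewrite -subset0 => t [[_ Qt] [_ /(_ Qt)]].
- exact: measurableI.
rewrite [X in (_ + X)%R]SQ0 adde0; apply: le_measure; rewrite ?inE//; exact: measurableI.
Qed.

Lemma ae_le_trans y x z : ae_le mu x y -> ae_le mu y z -> ae_le mu x z.
Proof. by apply: filterS2 => t; exact: le_trans. Qed.

Lemma LinfD f g : Linf mu f -> Linf mu g -> Linf mu (f \+ g).
Proof.
move=> [mf [M fM]] [mg [N gN]]; split; first exact: measurable_funD.
exists (M + N); apply: filterS2 fM gN => t ft gt.
by rewrite (le_trans (ler_normD _ _))// lerD.
Qed.

Lemma LinfZ f (k : R) : Linf mu f -> Linf mu (k \*o f).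
Proof.
move=> [mf [M fM]]; split; first exact: measurable_funM.
exists (`|k| * M); apply: filterS fM => t ft /=.
by rewrite normrM ler_wpM2l.
Qed.

(** * Order convergent nets: the gap between the squeezing nets *)

Section Net.
Variables (G : Type) (le : G -> G -> Prop).
Hypothesis dirle : directed le.
Variables (x : T -> R) (ys zs : G -> T -> R).
Hypotheses (x1 : Linf mu x) (yz1 : forall a, Linf mu (ys a) /\ Linf mu (zs a))
  (ys_incr : forall a b, le a b -> ae_le mu (ys a) (ys b))
  (ys_le : forall a, ae_le mu (ys a) x)
  (ys_sup : forall u, Linf mu u -> (forall a, ae_le mu (ys a) u) -> ae_le mu x u)
  (zs_decr : forall a b, le a b -> ae_le mu (zs b) (zs a))
  (zs_ge : forall a, ae_le mu x (zs a))
  (zs_inf : forall u, Linf mu u -> (forall a, ae_le mu u (zs a)) -> ae_le mu u x).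

Lemma directed_bound_finite (a : nat -> G) (n : nat) :
  exists c, forall k, (k <= n)%N -> le (a k) c.
Proof.
have [_ letr _ ledir] := dirle.
elim: n => [|n [c cP]].
  have [c [ac _]] := ledir (a 0%N) (a 0%N).
  by exists c => k; rewrite leqn0 => /eqP ->.
have [c' [cc' ac']] := ledir c (a n.+1).
exists c' => k; rewrite leq_eqVlt => /predU1P[->//|/cP kc].
exact: letr kc cc'.
Qed.

(** By directedness [ys a + e 1_D] lies below every [zs b], hence below the infimum [x]. Then
    [x - e 1_D] is an upper bound of [ys], so it dominates the supremum [x], which forces [D] to be
    null. *)
Lemma order_squeeze_null (e : R) (D : set T) : 0 < e -> measurable D ->
  (forall a, {ae mu, forall t, D t -> e <= zs a t - ys a t}) -> mu D = 0%E.
Proof.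
move=> e0 mD HD; have [_ _ _ ledir] := dirle.
have eD1 := LinfZ e (Linf_indic mu mD).
have yz a b : ae_le mu (ys a \+ (e \*o \1_D)) (zs b).
  have [c [ac bc]] := ledir a b.
  have yx := ae_le_trans (ys_le c) (zs_ge c).
  have := aeI (ys_incr ac) (aeI (zs_decr bc) (aeI yx (HD c))).
  apply: filterS => t [ya [zb [yzc Dc]]] /=.
  rewrite indicE; have [tD|tD] := boolP (t \in D).
    have := Dc (set_mem tD); rewrite mulr1; lra.
  rewrite mulr0; lra.
have yx a : ae_le mu (ys a \+ (e \*o \1_D)) x.
  apply: zs_inf; last exact: yz.
  by apply: LinfD => //; exact: (yz1 a).1.
have xx : ae_le mu x (x \+ ((- 1) \*o (e \*o \1_D))).
  apply: ys_sup; first by apply: LinfD => //; exact: LinfZ.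
  by move=> a; apply: filterS (yx a) => t /=; lra.
apply: ae_not_measure0 => //; apply: filterS xx => t /= + Dt.
by rewrite indicE mem_set//= mulr1; lra.
Qed.

(* The sets where the gap [zs a - ys a] is at least [e] decrease along the net,
and their essential intersection carries a gap that no upper bound of [ys]
below all the [zs] can fill. *)
Lemma order_squeeze_measure (E : set T) (e r : R) : measurable E ->
  (mu E < +oo)%E -> 0 < e -> 0 < r ->
  exists a, measurable (E `&` [set t | e <= zs a t - ys a t]) /\
    fine (mu (E `&` [set t | e <= zs a t - ys a t])) < r.
Proof.
move=> mE Efin e0 r0; have [_ _ [g0] ledir] := dirle.
pose D a := E `&` [set t | e <= zs a t - ys a t].
have mD a : measurable (D a).
  have mzy : measurable_fun setT (zs a \- ys a).
    by apply: measurable_funB; [case: (yz1 a).2|case: (yz1 a).1].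
  apply: measurableI => //.
  have := mzy measurableT _ (measurable_itv `[e, +oo[); rewrite setTI.
  by congr measurable; apply/seteqP; split => t /=; rewrite in_itv/= andbT.
have DE a : D a `<=` E by move=> t [].
apply: contrapT => H.
have Dr a : r <= fine (mu (D a)).
  by rewrite leNgt; apply/negP => lt; apply: H; exists a; split; [exact: mD|].
have Ddecr a b : le a b -> {ae mu, forall t, D b t -> D a t}.
  move=> ab; apply: filterS2 (ys_incr ab) (zs_decr ab) => t yt zt [Et Dt].
  by split => //=; move: Dt => /=; lra.
pose V := [set fine (mu (D a)) | a in [set: G]].
have Vinf : has_inf V.
  split; first by exists (fine (mu (D g0))), g0.
  by exists r => _ [a _ <-].
have rV : r <= inf V.
  by apply: lb_le_inf; [exact: Vinf.1|move=> _ [a _ <-]].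
(* A sequence of indices along which the measures approach their infimum replaces the net, so that
   countable intersections suffice. *)
have aP n : {a | fine (mu (D a)) < inf V + n.+1%:R^-1}.
  apply: cid; have [|_ [a _ <-] aV] := @inf_adherent _ V n.+1%:R^-1 _ Vinf => //.
  by exists a.
pose a n := sval (aP n).
pose F n := \bigcap_(k in [set k | (k <= n)%N]) D (a k).
have mF n : measurable (F n) by apply: bigcap_measurable => //; exists 0%N.
have FE n : F n `<=` E by move=> t /(_ 0%N (leq0n _)) /DE.
(* The indices [a k] need not increase, but finitely many have a common upper index [c], and [D c]
   is almost contained in [F n]. *)
have VF n : inf V <= fine (mu (F n)).
  have [c cP] := directed_bound_finite a n.
  apply: (@le_trans _ _ (fine (mu (D c)))).
    by apply: (ge_inf Vinf.2); exists c.
  rewrite -lee_fin -!(measure_sub_fin mE Efin)//.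
  apply: le_measure_ae => //.
  have : {ae mu, forall t, forall k, (k <= n)%N -> D c t -> D (a k) t}.
    apply: ae_foralln => k; have [kn|nk] := leqP k n; last exact: aeW.
    by apply: filterS (Ddecr _ _ (cP k kn)) => t Dt _.
  by apply: filterS => t Dt Dct k kn; exact: Dt.
have mL : measurable (\bigcap_n F n) by exact: bigcapT_measurable.
have LE : \bigcap_n F n `<=` E by move=> t /(_ 0%N I) /FE.
have VL : ((inf V)%:E <= mu (\bigcap_n F n))%E.
  have cvgF : mu \o F @ \oo --> mu (\bigcap_n F n).
    apply: nonincreasing_cvg_mu => //.
      by rewrite (measure_sub_fin mE Efin)// ltry.
    move=> n k nk; apply/subsetPset => t Ft i /= ni.
    by apply: Ft; rewrite /= (leq_trans ni).
  rewrite -(cvg_lim _ cvgF)//; apply: lime_ge.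
    by apply/cvg_ex; exists (mu (\bigcap_n F n)).
  by apply: nearW => n /=; rewrite (measure_sub_fin mE Efin)// lee_fin.
suff L0 : mu (\bigcap_n F n) = 0%E by move: VL; rewrite L0 lee_fin; lra.
apply: (order_squeeze_null e0 mL) => b.
have mLb : measurable (\bigcap_n F n `\` D b) by exact: measurableD.
suff : mu (\bigcap_n F n `\` D b) = 0%E.
  move=> Lb0; exists (\bigcap_n F n `\` D b); split => // t /= nt.
  apply: contrapT => nLD; apply: nt => Lt; apply: contrapT => ne.
  by apply: nLD; split => // -[].
apply/eqP; rewrite -measure_le0; apply/lee_addgt0Pr => u u0; rewrite add0e.
have [N hN] := near_invSn u0.
(* Almost all of [D c] lies in both [D b] and [D (a N)], so their intersection has measure at least
   [inf V]; by the choice of [a N], less than [1 / (N + 1)] is left outside [D b]. *)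
have [c [bc ac]] := ledir b (a N).
have mDD : measurable (D (a N) `\` D b) by exact: measurableD.
have DDE : D (a N) `\` D b `<=` E by move=> t [/DE].
apply: (@le_trans _ _ (mu (D (a N) `\` D b))).
  apply: le_measure; rewrite ?inE// => t [Lt nD]; split => //.
  exact: (Lt N I N (leqnn N)).
rewrite (measure_sub_fin mE Efin)// lee_fin ltW//.
apply: le_lt_trans (hN N (leqnn _)).
have := svalP (aP N); rewrite -/(a N).
rewrite (fine_measureID mE Efin (mD b) (mD (a N)) (@DE _)).
have : inf V <= fine (mu (D (a N) `&` D b)).
  apply: (@le_trans _ _ (fine (mu (D c)))).
    by apply: (ge_inf Vinf.2); exists c.
  have mI : measurable (D (a N) `&` D b) by exact: measurableI.
  have IE : D (a N) `&` D b `<=` E by move=> t [/DE].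
  rewrite -lee_fin -!(measure_sub_fin mE Efin)//.
  apply: le_measure_ae => //.
  by apply: filterS2 (Ddecr _ _ bc) (Ddecr _ _ ac) => t Db Da Dc; split; auto.
by move: (N.+1%:R^-1) => w; lra.
Qed.

End Net.

(** * The set of spikes is order closed *)

Variables (E1 E2 : set T) (B V : nat -> set T) (nu : nat -> nat).
Hypotheses (mE1 : measurable E1) (E1fin : (mu E1 < +oo)%E)
  (E1pos : 0 < fine (mu E1)) (E12 : E1 `&` E2 = set0)
  (mB : forall p, measurable (B p)) (BE1 : forall p, B p `<=` E1)
  (Bsep : forall p p', (p < p')%N ->
    fine (mu (B p `\` B p' `|` B p' `\` B p)) = fine (mu E1) / 2)
  (mV : forall p, measurable (V p)) (VE2 : forall p, V p `<=` E2)
  (Vpos : forall p, mu (V p) <> 0%E).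

Definition spike (p : nat) : T -> R := fun t =>
  (nu p).+1%:R^-1 * \1_(B p) t + (nu p).+1%:R * \1_(V p) t.

(** Saturated under almost everywhere equality, because functions stand for their classes and order
    limits are unique only up to null sets. *)
Definition spikes : set (T -> R) :=
  [set f | Linf mu f /\ exists p, {ae mu, forall t, f t = spike p t}].

Lemma Linf_spike p : Linf mu (spike p).
Proof.
by apply: (@LinfD ((nu p).+1%:R^-1 \*o \1_(B p)) ((nu p).+1%:R \*o \1_(V p)));
  apply: LinfZ; exact: Linf_indic.
Qed.

Lemma spike_E1 p t : E1 t -> spike p t = (nu p).+1%:R^-1 * \1_(B p) t.
Proof.
move=> Et; rewrite /spike [\1_(V p) t]indicE memNset ?mulr0 ?addr0//.
by move=> /VE2 E2t; have : (E1 `&` E2) t by []; rewrite E12.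
Qed.

Lemma spike_V_ge p t : V p t -> (nu p).+1%:R <= spike p t.
Proof.
move=> Vt; rewrite /spike [\1_(V p) t]indicE mem_set// mulr1 lerDr.
by rewrite mulr_ge0// invr_ge0.
Qed.

(** On the symmetric difference of [B p] and [B p'] one spike vanishes and the other equals its
    coefficient. *)
Lemma spike_sep p p' (e : R) : p <> p' -> e <= (nu p).+1%:R^-1 ->
  e <= (nu p').+1%:R^-1 -> exists W, [/\ measurable W, W `<=` E1,
    fine (mu W) = fine (mu E1) / 2 &
    forall t, W t -> e <= `|spike p t - spike p' t|].
Proof.
move=> pp' ep ep'; exists (B p `\` B p' `|` B p' `\` B p); split.
- by apply: measurableU; exact: measurableD.
- by move=> t [[/BE1]|[/BE1]].
- have [/Bsep//|/Bsep|//] := ltngtP p p'.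
  by rewrite setUC.
move=> t [|] [Bt nBt]; have Et := BE1 Bt; rewrite !spike_E1// !indicE.
  by rewrite mem_set// memNset// mulr0 mulr1 subr0 ger0_norm.
by rewrite memNset// mem_set// mulr0 mulr1 sub0r normrN ger0_norm.
Qed.

Lemma spikes_order_closed : order_closed mu spikes.
Proof.
split; first by move=> f [].
move=> G le dirle xs x Fxs x1 [ys [zs [yz1 [yi [yl [ysup [zd [zg [zinf
  [a0 a0P]]]]]]]]]].
have [lerefl letr _ ledir] := dirle.
have [M zM] := (yz1 a0).2.2.
(* From [a0] on the net lies below [zs a0], hence below [M], while a spike reaches [nu p + 1] on the
   nonnull set [V p]. *)
have nuM a p : le a0 a -> {ae mu, forall t, xs a t = spike p t} ->
    (nu p).+1%:R <= M.
  move=> a0a xp; rewrite leNgt; apply/negP => Mlt; apply: (Vpos (p := p)).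
  apply: ae_not_measure0 => //.
  have := aeI (a0P a a0a).2 (aeI (zd _ _ a0a) (aeI zM xp)).
  apply: filterS => t [xz [zz [zMt xt]]] /spike_V_ge.
  have := ler_norm (zs a0 t); lra.
have M0 : 0 < M.
  have [_ [p xp]] := Fxs a0; apply: lt_le_trans (nuM a0 p (lerefl _) xp).
  by rewrite ltr0n.
have nuMV a p : le a0 a -> {ae mu, forall t, xs a t = spike p t} ->
    M^-1 <= (nu p).+1%:R^-1.
  by move=> a0a xp; rewrite lef_pV2 ?posrE// (nuM a).
have Mi0 : 0 < M^-1 by rewrite invr_gt0.
have E1h : 0 < fine (mu E1) / 2 by rewrite divr_gt0.
(* Beyond [a1] two members of the net can differ by [M^-1] only on less than half of [E1], whereas
   distinct spikes do so on exactly half of it or more. *)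
have [a1 [mD Dlt]] := order_squeeze_measure dirle x1 yz1 yi yl ysup zd zg zinf
  mE1 E1fin Mi0 E1h.
have [a2 [a02 a12]] := ledir a0 a1.
have [_ [p xp]] := Fxs a2.
have xbp b : le a2 b -> {ae mu, forall t, xs b t = spike p t}.
  move=> a2b; have [_ [p' xp']] := Fxs b.
  have a0b := letr _ _ _ a02 a2b; have a1b := letr _ _ _ a12 a2b.
  have [->//|/eqP pp'] := eqVneq p p'; exfalso.
  have [W [mW WE Wm Wsep]] :=
    spike_sep pp' (nuMV _ _ a02 xp) (nuMV _ _ a0b xp').
  suff : (mu W <= mu (E1 `&` [set t | (M^-1 <= zs a1 t - ys a1 t)%R]))%E.
    rewrite (measure_sub_fin mE1 E1fin mW WE).
    rewrite (measure_sub_fin mE1 E1fin mD (@subIsetl _ _ _)).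
    by rewrite lee_fin Wm leNgt Dlt.
  apply: le_measure_ae => //.
  have := aeI (a0P _ a02).1 (aeI (a0P _ a02).2 (aeI (a0P _ a0b).1
   (aeI (a0P _ a0b).2 (aeI (aeI (yi _ _ a12) (yi _ _ a1b)) (aeI
   (aeI (zd _ _ a12) (zd _ _ a1b)) (aeI xp xp')))))).
  apply: filterS => t [y2 [z2 [yb [zb [[y12 y1b] [[z12 z1b] [ep ep']]]]]]] Wt.
  split; first exact: WE.
  rewrite /=; apply: le_trans (Wsep t Wt) _; rewrite -ep -ep' ler_norml.
  apply/andP; split; lra.
split => //; exists p.
(* As the net is eventually [spike p], this function bounds all [ys] from above and all [zs] from
   below. *)
have xle : ae_le mu x (spike p).
  apply: ysup; first exact: Linf_spike.
  move=> a; have [b [ab a2b]] := ledir a a2.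
  have := aeI (yi _ _ ab) (aeI (a0P b (letr _ _ _ a02 a2b)).1
    (xbp b a2b)).
  by apply: filterS => t [ya [yb <-]]; exact: le_trans ya yb.
have xge : ae_le mu (spike p) x.
  apply: zinf; first exact: Linf_spike.
  move=> a; have [b [ab a2b]] := ledir a a2.
  have := aeI (zd _ _ ab) (aeI (a0P b (letr _ _ _ a02 a2b)).2
    (xbp b a2b)).
  by apply: filterS => t [za [zb <-]]; exact: le_trans zb za.
by apply: filterS2 xle xge => t ? ?; apply/eqP; rewrite eq_le; apply/andP.
Qed.

(** * The spikes accumulate at 0 in the Mackey topology *)

Hypotheses (E1atomless : no_atoms_in mu E1)
  (Vsmall : forall r : R, 0 < r -> exists N, forall p, (N <= p)%N ->
    (mu (V p) < r%:E)%E)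
  (nu_often : forall n N, exists2 p, (N <= p)%N & nu p = n).

Lemma pairing_spike p g : L1 mu g -> pairing mu (spike p) g =
  (nu p).+1%:R^-1 * \int[mu]_(t in B p) g t
  + (nu p).+1%:R * \int[mu]_(t in V p) g t.
Proof.
move=> g1; rewrite -!pairing_indic /pairing -!/(Rintegral mu setT _).
have I S (k : R) : measurable S ->
    mu.-integrable setT (EFin \o (fun t => k * (\1_S t * g t))).
  move=> mS; have := pairing_integrable (Linf_indic mu mS) g1.
  exact: integrableZl.
rewrite -!RintegralZl//; last 2 first.
- exact: pairing_integrable (Linf_indic mu (mV p)) g1.
- exact: pairing_integrable (Linf_indic mu (mB p)) g1.
rewrite -RintegralD//; last 2 first.
- exact: I.
- exact: I.
by apply: eq_Rintegral => t _; rewrite /spike; ring.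
Qed.

Lemma spikes_not_mackey_closed : ~ mackey_closed mu spikes.
Proof.
move=> [_ [_ /(_ (cst 0))]].
have L0 : Linf mu (cst 0).
  by split => //; exists 0; apply: aeW => t; rewrite normr0.
case.
  split => // -[_ [p sp]]; apply: (Vpos (p := p)); apply: ae_not_measure0 => //.
  apply: filterS sp => t st /spike_V_ge; rewrite -st.
  by rewrite leNgt ltr0n.
move=> n [Ks [e [KsP e0 nbhd]]].
(* [N1] is a value of [nu], not an index: the integrals over all [B p] share a bound [M], so the
   first term is small as soon as [nu p] is large, whatever [p] is. *)
have [|N1 hN1] := @eventually_finite n (fun i k => forall p g, Ks i g ->
    nu p = k -> `|(nu p).+1%:R^-1 * \int[mu]_(t in B p) g t| < e / 2).
  move=> i /KsP[cK wK].
  have [M M0 hM] := weak_compact_bounded cK wK mE1 E1fin E1atomless.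
  have eM : 0 < e / 2 / M by rewrite !divr_gt0.
  have [N hN] := near_invSn eM.
  exists N => k Nk p g Kg ->; rewrite normrM ger0_norm ?invr_ge0//.
  apply: (@le_lt_trans _ _ (k.+1%:R^-1 * M)).
    by apply: ler_wpM2l; [rewrite invr_ge0|exact: hM].
  by rewrite -ltr_pdivlMr// hN.
(* With the height [N1 + 1] now fixed, uniform integrability makes the second term small for large
   [p]. *)
have [|N2 hN2] := @eventually_finite n (fun i p => forall g, Ks i g ->
    `|N1.+1%:R * \int[mu]_(t in V p) g t| < e / 2).
  move=> i /KsP[cK wK].
  have eN : 0 < e / 2 / N1.+1%:R by rewrite !divr_gt0// ltr0n.
  have [r r0 hr] := weak_compact_uniform_integral cK wK eN.
  have [N hN] := Vsmall r0.
  exists N => p /hN Vp g Kg; rewrite normrM ger0_norm// mulrC.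
  by rewrite -ltr_pdivlMr ?ltr0n//; exact: hr.
have [p N2p nup] := nu_often N1 N2.
have [] := nbhd (spike p) (Linf_spike p).
  move=> i lin g Kg; have g1 : L1 mu g by exact: (KsP i lin).2.1.
  have -> : spike p \- cst 0 = spike p by apply/funext => t /=; rewrite subr0.
  rewrite pairing_spike// (le_lt_trans (ler_normD _ _))//.
  have := hN1 N1 (leqnn _) i lin p g Kg nup; rewrite nup.
  have := hN2 p N2p i lin g Kg.
  move: (`|_|) (`|_|) => a b; lra.
by move=> _ []; split; [exact: Linf_spike|exists p; exact: aeW].
Qed.

End OrderClosed.

(** * Choice of the sets and of [nu] in the given space *)

Theorem mainTheorem10 (d : measure_display) (T : measurableType d) (R : realType)
    (mu : {measure set T -> \bar R}) (A : set T) :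
  semi_finite mu -> measurable A -> mu A <> 0%E -> no_atoms_in mu A ->
  order_closed mu <> mackey_closed mu.
Proof.
move=> sf mA A0 Aatomless closedE.
(* Semi-finiteness provides [E] when [A] has infinite measure. *)
have [E [mE EA E0 Efin]] : exists E, [/\ measurable E, E `<=` A, (0 < mu E)%E &
    (mu E < +oo)%E].
  have [Aoo|] := eqVneq (mu A) +oo%E; first exact: sf.
  rewrite -ltey => Afin; exists A; split => //.
  by rewrite lt0e measure_ge0 andbT; apply/eqP.
have atomless_sub S : S `<=` A -> no_atoms_in mu S.
  move=> SA [Q [QS atomQ]]; apply: Aatomless; exists Q; split => //.
  exact: (subset_trans QS).
have Eatomless := atomless_sub _ EA.
have {}E0 : 0 < fine (mu E) by rewrite fine_gt0// E0.
have [|E1 [mE1 E1E E1m]] := @atomless_subset_measure _ _ _ mu E mE Efin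
  Eatomless E (fine (mu E) / 2) mE (@subset_refl _ _).
  by apply/andP; split; lra.
have E1fin : (mu E1 < +oo)%E by rewrite (measure_sub_fin mE Efin)// ltry.
have E1pos : 0 < fine (mu E1) by rewrite E1m; lra.
have E1atomless := atomless_sub _ (subset_trans E1E EA).
have mE2 : measurable (E `\` E1) by exact: measurableD.
have E2E : E `\` E1 `<=` E by move=> t [].
have E2m : fine (mu (E `\` E1)) = fine (mu E1).
  by rewrite (fine_measureD mE Efin)// E1m; lra.
have [B [BP Bsep]] := atomless_rademacher mE1 E1fin E1atomless mE1
  (@subset_refl _ _).
have [V VP] := atomless_shrinking mE Efin Eatomless mE2 E2E.
have VE p : V p `<=` E by apply: subset_trans E2E; case: (VP p).
have mV p : measurable (V p) by case: (VP p).
have muV p : mu (V p) = (fine (mu E1) / 2 ^+ p)%:E.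
  by rewrite (measure_sub_fin mE Efin)//; case: (VP p) => _ _ ->; rewrite E2m.
have E12 : E1 `&` (E `\` E1) = set0.
  by rewrite -subset0 => t [E1t [_ /(_ E1t)]].
(* The 2-adic valuation takes each value infinitely often: [2 ^ n * 3 ^ N] has valuation [n] and
   exceeds [N]. The shift by one avoids the argument 0. *)
pose nu p := logn 2 p.+1.
have nu_often n N : exists2 p, (N <= p)%N & nu p = n.
  exists (2 ^ n * 3 ^ N).-1.
    rewrite -ltnS prednK ?muln_gt0 ?expn_gt0//.
    by rewrite (leq_trans (ltn_expl N (isT : 1 < 3)%N))// leq_pmull ?expn_gt0.
  rewrite /nu prednK ?muln_gt0 ?expn_gt0// lognM ?expn_gt0//.
  by rewrite pfactorK// lognX muln0 addn0.
have mB p : measurable (B p) by case: (BP p).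
have BE1 p : B p `<=` E1 by case: (BP p).
have VE2 p : V p `<=` E `\` E1 by case: (VP p).
have Vpos p : mu (V p) <> 0%E.
  rewrite muV => -[] /eqP; apply/negP.
  by rewrite gt_eqF// divr_gt0// exprn_gt0.
have Vsmall r : 0 < r -> exists N, forall p, (N <= p)%N -> (mu (V p) < r%:E)%E.
  move=> r0; have rE : 0 < r / fine (mu E1) by rewrite divr_gt0.
  have [N hN] := near_invSn rE.
  exists N => p /hN pr; rewrite muV lte_fin mulrC -ltr_pdivlMr//.
  apply: le_lt_trans pr; rewrite lef_pV2 ?posrE ?exprn_gt0//.
  by rewrite -natrX ler_nat ltn_expl.
apply: (@spikes_not_mackey_closed _ _ _ mu E1 B V nu) => //.
rewrite -closedE.
exact: (@spikes_order_closed _ _ _ mu E1 (E `\` E1)).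
Qed.
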